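(* Let $X={\mathbb R}^2$ with coordinates $(x^0,x^1)$, $Y={\mathbb R}^2\times{\mathbb R}$ with the trivial connection, and let ${\mathcal L}=L(\phi,\partial_0\phi,\partial_1\phi)\,dx^1\wedge dx^0$ be a Lagrangian density with no explicit dependence on $(x^0,x^1)$. If ${\mathbb F}{\mathcal L}:J^1(Y)\to P_{\mathcal L}$ is a fiber bundle diffeomorphism and $\phi\in\Gamma(\pi_{XY})$, then $\tilde{j}^1(\phi)$ is a Hamiltonian section for ${\mathcal H}$ if and only if $$\frac{\partial\tilde{j}^1(\phi)}{\partial x^0}\lrcorner\,(dp^0\wedge d\phi)+\frac{\partial\tilde{j}^1(\phi)}{\partial x^1}\lrcorner\,(dp^1\wedge d\phi)=-dH(\tilde{j}^1(\phi))$$ (an equality of covectors on $P_{\mathcal L}$ at the points of $\tilde{j}^1(\phi)$). Moreover, this equation is equivalent to Bridges' equation for ${\mathcal Z}=(\phi,p^0,p^1)$ (the fiber components of $\tilde{j}^1(\phi)$), $$\Big(\frac{\partial{\mathcal Z}}{\partial x^0}\Big)^{T}M+\Big(\frac{\partial{\mathcal Z}}{\partial x^1}\Big)^{T}K=-dH({\mathcal Z}),\qquad M=\begin{pmatrix}0&-1&0\\1&0&0\\0&0&0\end{pmatrix},\quad K=\begin{pmatrix}0&0&-1\\0&0&0\\1&0&0\end{pmatrix},$$ where $dH$ is the row vector $(\partial H/\partial\phi,\partial H/\partial p^0,\partial H/\partial p^1)$.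
   Context: $\Gamma(\pi_{XY})$ is the set of sections of $Y={\mathbb R}^2\times{\mathbb R}\to X={\mathbb R}^2$, i.e. smooth functions $\phi(x^0,x^1)$. $J^1(Y)$ has coordinates $(x^0,x^1,\phi,\phi_0,\phi_1)$ with $\phi_\mu=\partial\phi/\partial x^\mu$ along the first jet $j^1(\phi)$. The affine dual $J^1(Y)^\star$ (fiberwise affine maps from $J^1(Y)$ to $2$-forms on $X$) has coordinates $(x^0,x^1,\phi,p,p^0,p^1)$, representing $(\phi_0,\phi_1)\mapsto(p+p^\mu\phi_\mu)\,dx^1\wedge dx^0$. The covariant Legendre transformation ${\mathbb F}{\mathcal L}:J^1(Y)\to J^1(Y)^\star$ is given by $p^\mu=\partial L/\partial\phi_\mu$, $p=L-p^\mu\phi_\mu$, and $P_{\mathcal L}={\mathbb F}{\mathcal L}(J^1(Y))$, coordinatized by $(x^0,x^1,\phi,p^0,p^1)$. The covariant Hamiltonian density on $P_{\mathcal L}$ (trivial connection) is ${\mathcal H}=H\,dx^1\wedge dx^0$ with $H=p^\mu\phi_\mu-L$ regarded as a function of $(\phi,p^0,p^1)$. The canonical $3$-form on $P_{\mathcal L}$ is $$\Omega_{\mathcal H}=-d\phi\wedge dp^0\wedge dx^1+d\phi\wedge dp^1\wedge dx^0+dH\wedge dx^1\wedge dx^0.$$ $\tilde{j}^1(\phi)={\mathbb F}{\mathcal L}\circ j^1(\phi)$, and it is called a Hamiltonian section for ${\mathcal H}$ if $\tilde{j}^1(\phi)^*(U\lrcorner\,\Omega_{\mathcal H})=0$ for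 every vector field $U$ on $P_{\mathcal L}$ ($\lrcorner$ is interior product). $M$ and $K$ are identified with the degenerate $2$-forms $dp^0\wedge d\phi$ and $dp^1\wedge d\phi$ by $(u,v)\mapsto u^TMv$, $u^TKv$. *)

(* Defs.v *)
From HB Require Import structures.
From mathcomp Require Import all_boot all_order all_algebra.
From mathcomp Require Import all_classical all_reals all_analysis.

Set Implicit Arguments.
Unset Strict Implicit.
Unset Printing Implicit Defensive.
Import Order.TTheory GRing.Theory Num.Theory.
Import numFieldNormedType.Exports.

Local Open Scope classical_set_scope.
Local Open Scope ring_scope.

Section Smooth.
Variable R : realType.

(* Used with [A] open and [V], [W] finite-dimensional, where it is the usual
   [C^k] condition. *)
Fixpoint Ck (V W : normedModType R) (k : nat) (A : set V) (f : V -> W) : Prop :=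
  if k is k'.+1 then
    (forall x, A x -> differentiable f x) /\ (forall v, Ck k' A ('D_v f))
  else forall x, A x -> {for x, continuous f}.

Definition smooth_on (V W : normedModType R) (A : set V) (f : V -> W) : Prop :=
  forall k, Ck k A f.

Definition smooth (V W : normedModType R) (f : V -> W) : Prop :=
  smooth_on setT f.

End Smooth.

Section Forms.
Variable R : realType.

(* A [k]-form on (an open subset of) [V] is given by its values on [k]-tuples
   of tangent vectors; all the forms below are built from wedge products of
   differentials, hence alternating and multilinear. *)
Definition form (V : normedModType R) (k : nat) : Type := V -> k.-tuple V -> R.

Definition dform (V : normedModType R) (f : V -> R) : form V 1 :=
  fun x v => 'd f x (thead v).

(* a_1 /\ ... /\ a_k (v_1, ..., v_k) = det (a_i (v_j)); in particular
   (a /\ b) (u, v) = a u * b v - a v * b u. *)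
Definition wedge (V : normedModType R) (k : nat) (a : k.-tuple (form V 1)) :
    form V k :=
  fun x v => \det (\matrix_(i < k, j < k) tnth a i x [tuple tnth v j]).

Definition iprod (V : normedModType R) (k : nat) (u : V)
    (w : k.+1.-tuple V -> R) : k.-tuple V -> R :=
  fun v => w [tuple of u :: v].

Definition iprod_form (V : normedModType R) (k : nat) (U : V -> V)
    (w : form V k.+1) : form V k :=
  fun x => iprod (U x) (w x).

Definition pullback (V W : normedModType R) (k : nat) (f : V -> W)
    (w : form W k) : form V k :=
  fun x v => w (f x) [tuple of map ('d f x) v].

End Forms.

Section Jets.
Variable R : realType.

Definition vec (n : nat) (s : seq R) : 'rV[R]_n := \row_(i < n) s`_i.

Definition e_ (n : nat) (i : 'I_n) : 'rV[R]_n := delta_mx 0 i.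

Definition partial (n : nat) (V : normedModType R) (f : 'rV[R]_n -> V)
    (i : 'I_n) : 'rV[R]_n -> V := 'D_(e_ i) f.

(* Points of X are (x^0, x^1), points of Y are (x^0, x^1, phi), points of
   J^1(Y) are (x^0, x^1, phi, phi_0, phi_1), points of J^1(Y)^* are
   (x^0, x^1, phi, p, p^0, p^1), and points of P_L, in its coordinates, are
   (x^0, x^1, phi, p^0, p^1). *)

Definition proj_Y (z : 'rV[R]_5) : 'rV[R]_3 := vec 3 [:: z 0 0; z 0 1; z 0 2].

Definition fiber (z : 'rV[R]_5) : 'rV[R]_3 := vec 3 [:: z 0 2; z 0 3; z 0 4].

Definition j1 (phi : 'rV[R]_2 -> R) (x : 'rV[R]_2) : 'rV[R]_5 :=
  vec 5 [:: x 0 0; x 0 1; phi x; partial phi 0 x; partial phi 1 x].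

Section Lagrangian.
(* L is a function of (phi, phi_0, phi_1). *)
Variable L : 'rV[R]_3 -> R.

Definition mom0 (y : 'rV[R]_3) : R := partial L 1 y.
Definition mom1 (y : 'rV[R]_3) : R := partial L 2 y.

Definition legendre (z : 'rV[R]_5) : 'rV[R]_6 :=
  let y := fiber z in
  vec 6 [:: z 0 0; z 0 1; z 0 2;
            L y - (mom0 y * y 0 1 + mom1 y * y 0 2); mom0 y; mom1 y].

Definition P_L : set 'rV[R]_6 := range legendre.

(* The coordinates (x^0, x^1, phi, p^0, p^1) on P_L. *)
Definition chart (w : 'rV[R]_6) : 'rV[R]_5 :=
  vec 5 [:: w 0 0; w 0 1; w 0 2; w 0 4; w 0 5].

Definition P_L_coord : set 'rV[R]_5 := chart @` P_L.

Definition legendre_coord : 'rV[R]_5 -> 'rV[R]_5 := chart \o legendre.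

(* FL : J^1(Y) -> P_L is a diffeomorphism of bundles over Y; the manifold
   structure of P_L is the one given by [chart], so its image must be open. *)
Definition legendre_bundle_diffeo : Prop :=
  [/\ open P_L_coord,
      {in P_L &, injective chart},
      forall z, proj_Y (legendre_coord z) = proj_Y z,
      smooth legendre_coord
    & exists g : 'rV[R]_5 -> 'rV[R]_5,
        [/\ smooth_on P_L_coord g,
            forall z, g (legendre_coord z) = z
          & forall w, P_L_coord w -> legendre_coord (g w) = w]].

(* (phi, phi_0, phi_1) |-> (phi, p^0, p^1) *)
Definition fiber_legendre (y : 'rV[R]_3) : 'rV[R]_3 :=
  vec 3 [:: y 0 0; mom0 y; mom1 y].

Definition energy (y : 'rV[R]_3) : R :=
  mom0 y * y 0 1 + mom1 y * y 0 2 - L y.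

(* [energy] as a function of (phi, p^0, p^1), meaningful when
   [fiber_legendre] is injective and on its range. *)
Definition Hamiltonian : 'rV[R]_3 -> R := energy \o pinv setT fiber_legendre.

Definition H_coord : 'rV[R]_5 -> R := Hamiltonian \o fiber.

Definition coordinate (n : nat) (i : 'I_n) : 'rV[R]_n -> R := fun z => z 0 i.

Definition dx0 : form 'rV[R]_5 1 := dform (coordinate 0).
Definition dx1 : form 'rV[R]_5 1 := dform (coordinate 1).
Definition dphi : form 'rV[R]_5 1 := dform (coordinate 2).
Definition dp0 : form 'rV[R]_5 1 := dform (coordinate 3).
Definition dp1 : form 'rV[R]_5 1 := dform (coordinate 4).
Definition dH : form 'rV[R]_5 1 := dform H_coord.

Definition Omega_H : form 'rV[R]_5 3 :=
  fun z v => - wedge [tuple dphi; dp0; dx1] z v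
             + wedge [tuple dphi; dp1; dx0] z v
             + wedge [tuple dH; dx1; dx0] z v.

Section Section_of_Y.
Variable phi : 'rV[R]_2 -> R.

Definition jtilde : 'rV[R]_2 -> 'rV[R]_5 := legendre_coord \o j1 phi.

Definition Hamiltonian_section : Prop :=
  forall U : 'rV[R]_5 -> 'rV[R]_5, smooth_on P_L_coord U ->
  forall (x : 'rV[R]_2) (v : 2.-tuple 'rV[R]_2),
    pullback jtilde (iprod_form U Omega_H) x v = 0.

Definition covector_equation : Prop :=
  forall (x : 'rV[R]_2) (v : 1.-tuple 'rV[R]_5),
    iprod (partial jtilde 0 x) (wedge [tuple dp0; dphi] (jtilde x)) v
    + iprod (partial jtilde 1 x) (wedge [tuple dp1; dphi] (jtilde x)) v
    = - dH (jtilde x) v.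

(* Z = (phi, p^0, p^1); since Z is a row vector, the transposes of its
   derivatives in Bridges' equation are implicit. *)
Definition Zfield : 'rV[R]_2 -> 'rV[R]_3 := fiber \o jtilde.

Definition M_bridges : 'M[R]_3 :=
  \matrix_(i, j) (nth [::] [:: [:: 0; -1; 0];
                               [:: 1;  0; 0];
                               [:: 0;  0; 0]] i)`_j.

Definition K_bridges : 'M[R]_3 :=
  \matrix_(i, j) (nth [::] [:: [:: 0; 0; -1];
                               [:: 0; 0;  0];
                               [:: 1; 0;  0]] i)`_j.

Definition gradient (n : nat) (f : 'rV[R]_n -> R) (y : 'rV[R]_n) : 'rV[R]_n :=
  \row_i partial f i y.

Definition Bridges_equation : Prop :=
  forall x : 'rV[R]_2,
    partial Zfield 0 x *m M_bridges + partial Zfield 1 x *m K_bridges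
    = - gradient Hamiltonian (Zfield x).

End Section_of_Y.
End Lagrangian.
End Jets.

(* Main.v *)
(* All three conditions are Hamilton's equations written in components,
     dH/dphi = - (d_0 p^0 + d_1 p^1),  dH/dp^0 = d_0 phi,  dH/dp^1 = d_1 phi.
   For the covector and the Bridges equations this is read off coordinate by
   coordinate. For the section condition, the first two components of
   d_mu j~ are those of e_mu, so contracting Omega_H with U, d_0 j~, d_1 j~
   gives these equations as the coefficients of the fiber components of U; the
   coefficients of U^0 and U^1 are then zero by the chain rule for H o Z. The
   analytic input is the differentiability of H, which is locally the energy
   composed with the inverse Legendre map. *)
Require Import Defs.
From mathcomp Require Import all_boot all_order all_algebra.
From mathcomp Require Import all_classical all_reals all_analysis.
From mathcomp Require Import ring.
Import Order.TTheory GRing.Theory Num.Theory.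
Import numFieldNormedType.Exports.

Local Open Scope classical_set_scope.
Local Open Scope ring_scope.

(** * Determinants, wedge products and the pointwise algebra of the three conditions *)

Section LinearAlgebra.
Context {R : realType}.

Lemma ord3P (P : 'I_3 -> Prop) : P 0 -> P 1 -> P 2 -> forall i, P i.
Proof.
move=> P0 P1 P2 [[|[|[|//]]] p].
- by have -> : Ordinal p = 0 by exact: val_inj.
- by have -> : Ordinal p = 1 by exact: val_inj.
- by have -> : Ordinal p = 2 by exact: val_inj.
Qed.

Lemma ord5P (P : 'I_5 -> Prop) :
  P 0 -> P 1 -> P 2 -> P 3 -> P 4 -> forall i, P i.
Proof.
move=> P0 P1 P2 P3 P4 [[|[|[|[|[|//]]]]] p].
- by have -> : Ordinal p = 0 by exact: val_inj.
- by have -> : Ordinal p = 1 by exact: val_inj.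
- by have -> : Ordinal p = 2 by exact: val_inj.
- by have -> : Ordinal p = 3 by exact: val_inj.
- by have -> : Ordinal p = 4 by exact: val_inj.
Qed.

Lemma big_ord2 (V : nmodType) (F : 'I_2 -> V) : \sum_(i < 2) F i = F 0 + F 1.
Proof.
by rewrite !big_ord_recl big_ord0 addr0; congr (F _ + F _); exact: val_inj.
Qed.

Lemma big_ord3 (V : nmodType) (F : 'I_3 -> V) :
  \sum_(i < 3) F i = F 0 + F 1 + F 2.
Proof.
rewrite !big_ord_recl big_ord0 addr0 addrA.
by congr (F _ + F _ + F _); exact: val_inj.
Qed.

Lemma det_mx22 (A : 'M[R]_2) : \det A = A 0 0 * A 1 1 - A 0 1 * A 1 0.
Proof.
rewrite (expand_det_row _ 0) big_ord2 /cofactor !det_mx11 !mxE /=.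
have -> : lift (0 : 'I_2) (0 : 'I_1) = 1 by exact: val_inj.
have -> : lift (1 : 'I_2) (0 : 'I_1) = 0 by exact: val_inj.
by rewrite expr0 expr1; ring.
Qed.

Lemma det_mx33 (A : 'M[R]_3) :
  \det A = A 0 0 * (A 1 1 * A 2 2 - A 1 2 * A 2 1)
         - A 0 1 * (A 1 0 * A 2 2 - A 1 2 * A 2 0)
         + A 0 2 * (A 1 0 * A 2 1 - A 1 1 * A 2 0).
Proof.
rewrite (expand_det_row _ 0) big_ord3 /cofactor !det_mx22 !mxE /=.
have -> : lift (0 : 'I_3) (0 : 'I_2) = 1 by exact: val_inj.
have -> : lift (0 : 'I_3) (1 : 'I_2) = 2 by exact: val_inj.
have -> : lift (1 : 'I_3) (0 : 'I_2) = 0 by exact: val_inj.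
have -> : lift (1 : 'I_3) (1 : 'I_2) = 2 by exact: val_inj.
have -> : lift (2 : 'I_3) (0 : 'I_2) = 0 by exact: val_inj.
have -> : lift (2 : 'I_3) (1 : 'I_2) = 1 by exact: val_inj.
by rewrite expr0 expr1 expr2; ring.
Qed.

Lemma wedge2E (V : normedModType R) (a b : Defs.form V 1) (x u v : V) :
  wedge [tuple a; b] x [tuple u; v] =
  a x [tuple u] * b x [tuple v] - a x [tuple v] * b x [tuple u].
Proof. by rewrite /wedge det_mx22 !mxE. Qed.

(** The determinant with rows [f], [g], [h] and columns [u], [v], [w], expanded along its first row;
    plain functions instead of forms leave only a polynomial identity for [ring]. *)
Definition det3 {T : Type} (f g h : T -> R) (u v w : T) : R :=
  f u * (g v * h w - g w * h v) - f v * (g u * h w - g w * h u)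
  + f w * (g u * h v - g v * h u).

Lemma wedge3E (V : normedModType R) (a b c : Defs.form V 1) (x u v w : V) :
  wedge [tuple a; b; c] x [tuple u; v; w] =
  det3 (fun y => a x [tuple y]) (fun y => b x [tuple y])
       (fun y => c x [tuple y]) u v w.
Proof. by rewrite /wedge det_mx33 !mxE. Qed.

Lemma iprod1E (V : normedModType R) (u v : V) (w : 2.-tuple V -> R) :
  iprod u w [tuple v] = w [tuple u; v].
Proof. by congr (w _); exact: val_inj. Qed.

Lemma iprod2E (V : normedModType R) (u v v' : V) (w : 3.-tuple V -> R) :
  iprod u w [tuple v; v'] = w [tuple u; v; v'].
Proof. by congr (w _); exact: val_inj. Qed.

Lemma tuple1E (T : Type) (v : 1.-tuple T) : v = [tuple thead v].
Proof. by case: v => [[|a [|]]] // p; exact: val_inj. Qed.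

Lemma tuple2E (T : Type) (v : 2.-tuple T) : v = [tuple tnth v 0; tnth v 1].
Proof. by case: v => [[|a [|b [|]]]] // p; exact: val_inj. Qed.

Lemma linear3_inj (a b c a' b' c' : R) :
  (forall p q r, p * a + q * b + r * c = p * a' + q * b' + r * c') ->
  [/\ a = a', b = b' & c = c'].
Proof.
move=> E; split; [have := E 1 0 0 | have := E 0 1 0 | have := E 0 0 1];
  by rewrite !mul0r !mul1r ?addr0 ?add0r.
Qed.

Lemma vecE n (s : seq R) i : vec n s 0 i = s`_i.
Proof. by rewrite mxE. Qed.

(** Here [s], [t] play the derivatives of the section along x^0, x^1, and [a], [b], [c] the partial
    derivatives of H. Only the fiber entries of [v] occur, so comparing their coefficients
    suffices. *)
Lemma covector_components (s t : 'rV[R]_5) (a b c : R) :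
  (forall v : 'rV[R]_5,
    (s 0 3 * v 0 2 - v 0 3 * s 0 2) + (t 0 4 * v 0 2 - v 0 4 * t 0 2) =
    - (v 0 2 * a + v 0 3 * b + v 0 4 * c)) <->
  [/\ a = - (s 0 3 + t 0 4), b = s 0 2 & c = t 0 2].
Proof.
move: (s 0 2) (s 0 3) (t 0 2) (t 0 4) => s2 s3 t2 t4.
split=> [E|[-> -> ->] v]; last by ring.
apply: linear3_inj => p q r; have := E (vec 5 [:: 0; 0; p; q; r]).
rewrite !vecE /= => {}E.
by rewrite -[LHS]opprK -E; ring.
Qed.

(** A row (z0, z1, z2) times M is (z1, -z0, 0), and times K it is (z2, 0, -z0); each column then
    gives one equation up to sign. *)
Lemma Bridges_components (s t : 'rV[R]_5) (g : 'rV[R]_3) :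
  fiber s *m M_bridges R + fiber t *m K_bridges R = - g <->
  [/\ g 0 0 = - (s 0 3 + t 0 4), g 0 1 = s 0 2 & g 0 2 = t 0 2].
Proof.
split=> [/rowP E|[g0 g1 g2]]; last first.
  apply/rowP; apply: ord3P;
    by rewrite !(mxE, big_ord3) /= ?g0 ?g1 ?g2; ring.
have := (E 0, E 1, E 2); rewrite !(mxE, big_ord3) /= {E}.
move: (s 0 2) (s 0 3) (s 0 4) (t 0 2) (t 0 3) (t 0 4) (g 0 0) (g 0 1) (g 0 2).
move=> s2 s3 s4 t2 t3 t4 g0 g1 g2.
rewrite !(mulr0, mulr1, mulrN1, addr0, add0r, oppr0).
by move=> [[-> /oppr_inj ->] /oppr_inj ->]; rewrite opprK.
Qed.

(* [s] and [t] stand for the two partial derivatives of the section. Modulo the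
   three component equations, the coefficients of [u 0 0] and [u 0 1] vanish
   identically. *)
Lemma section_components (s t : 'rV[R]_5) (a b c : R)
    (h := fun v : 'rV[R]_5 => v 0 2 * a + v 0 3 * b + v 0 4 * c)
    (x := @coordinate R 5) :
  s 0 0 = 1 -> s 0 1 = 0 -> t 0 0 = 0 -> t 0 1 = 1 ->
  (forall (u : 'rV[R]_5) (v w : 'rV[R]_2),
     let V := v 0 0 *: s + v 0 1 *: t in
     let W := w 0 0 *: s + w 0 1 *: t in
     - det3 (x 2) (x 3) (x 1) u V W + det3 (x 2) (x 4) (x 0) u V W
     + det3 h (x 1) (x 0) u V W = 0) <->
  [/\ a = - (s 0 3 + t 0 4), b = s 0 2 & c = t 0 2].
Proof.
rewrite /det3 /h /x /coordinate => s0 s1 t0 t1.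
split=> [E|[-> -> ->] u v w /=]; last first.
  rewrite !mxE s0 s1 t0 t1.
  move: (s 0 2) (s 0 3) (s 0 4) (t 0 2) (t 0 3) (t 0 4) => s2 s3 s4 t2 t3 t4.
  move: (u 0 0) (u 0 1) (u 0 2) (u 0 3) (u 0 4) => u0 u1 u2 u3 u4.
  move: (v 0 0) (v 0 1) (w 0 0) (w 0 1) => v0 v1 w0 w1.
  by ring.
apply: linear3_inj => p q r.
(* A vertical [u] against V = [s], W = [t]: the term in [h] becomes [- h u], because the dx1, dx0
   minor of ([s], [t]) is -1. *)
have := E (vec 5 [:: 0; 0; p; q; r]) (vec 2 [:: 1; 0]) (vec 2 [:: 0; 1]).
rewrite !vecE /= !scale1r !scale0r addr0 add0r s0 s1 t0 t1.
move: (s 0 2) (s 0 3) (s 0 4) (t 0 2) (t 0 3) (t 0 4) => s2 s3 s4 t2 t3 t4 {}E.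
by rewrite -[LHS]addr0 -E; ring.
Qed.

End LinearAlgebra.

(** * Differentials of maps between row-vector spaces *)

Section Differentiability.
Context {R : realType}.

Lemma smooth_differentiable {V W : normedModType R} {f : V -> W} :
  smooth f -> forall x, differentiable f x.
Proof. by move=> f_smooth x; have [df _] := f_smooth 1%N; exact: df. Qed.

Lemma smooth_derive_differentiable {V W : normedModType R} {f : V -> W} :
  smooth f -> forall v x, differentiable ('D_v f) x.
Proof.
by move=> f_smooth v x; have [_ /(_ v)[df _]] := f_smooth 2; exact: df.
Qed.

Lemma smooth_on_cst {V W : normedModType R} (A : set V) (c : W) :
  smooth_on A (cst c).
Proof.
move=> k; elim: k c => [|k IHk] c /=.
  by move=> x _; exact: cst_continuous.
split=> [x _|v]; first exact: differentiable_cst.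
rewrite (_ : 'D_v (cst c) = cst 0) //.
by apply/funext => x; rewrite derive_cst.
Qed.

(** The first-order expansion of [f] at [x] is also one for [g], and uniqueness of the differential
    identifies its linear part with that of [g]. *)
Lemma near_eq_differentiable {V W : normedModType R} (f g : V -> W) (x : V) :
  (\near x, f x = g x) -> differentiable f x -> differentiable g x.
Proof.
move=> fg df.
have gE : g \o shift x = cst (g x) + 'd f x +o_ 0 id.
  have /eqaddoP fo := diff_locally df.
  have fg0 : \forall h \near (0 : V), f (h + x) = g (h + x).
    move: fg; rewrite (near_shift 0 x).
    by apply: filterS => h /=; rewrite subr0.
  have fgx : f x = g x := nbhs_singleton fg.
  apply/eqaddoP => _ /posnumP[e]; near=> h.
  rewrite -[(_ - _) h]/(g (h + x) - (g x + 'd f x h)) -fgx.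
  have <- : f (h + x) = g (h + x) by near: h.
  by near: h; exact: (fo _ (gt0 e)).
have dc : continuous ('d f x) by exact: diff_continuous.
by apply/diff_locallyP; rewrite (diff_unique dc gE); split.
Unshelve. all: by end_near. Qed.

Lemma diff_mxcoord {n} (i : 'I_n) (x v : 'rV[R]_n) :
  'd (fun y : 'rV[R]_n => y 0 i : R) x v = v 0 i.
Proof.
(* The coordinate is packaged as a linear map, so that [diff_lin] makes it its own differential. *)
have @f : {linear 'rV[R]_n -> R}.
  by exists (fun y : 'rV[R]_n => y 0 i); do 2![eexists]; do ?[constructor];
     rewrite ?mxE// => ? *; rewrite ?mxE//; move=> ?; rewrite !mxE.
rewrite (_ : (fun _ => _) = f) // diff_lin //; exact: coord_continuous.
Qed.

Lemma dcoordinateE n (i : 'I_n) (z v : 'rV[R]_n) :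
  dform (coordinate i) z [tuple v] = v 0 i.
Proof. exact: diff_mxcoord. Qed.

Lemma iprod_wedge_coordinateE n (i j : 'I_n) (z u v : 'rV[R]_n) :
  iprod u (wedge [tuple dform (coordinate i); dform (coordinate j)] z) [tuple v]
  = u 0 i * v 0 j - v 0 i * u 0 j.
Proof. by rewrite iprod1E wedge2E !dcoordinateE. Qed.

(** The first factor stays arbitrary so that both [dphi] and [dH] can take its place. *)
Lemma wedge3_coordinateE n (f : Defs.form 'rV[R]_n 1) (i j : 'I_n)
    (z u v w : 'rV[R]_n) :
  wedge [tuple f; dform (coordinate i); dform (coordinate j)] z [tuple u; v; w]
  = det3 (fun y => f z [tuple y]) (coordinate i) (coordinate j) u v w.
Proof. by rewrite wedge3E /det3 !dcoordinateE. Qed.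

Lemma differentiable_eq_coord {n} (j : 'I_n) (f : 'rV[R]_n -> R) x :
  f =1 (fun y => y 0 j) -> differentiable f x.
Proof. by move=> /funext ->; exact: differentiable_coord. Qed.

Lemma diff_eq_coord {n} (j : 'I_n) (f : 'rV[R]_n -> R) x v :
  f =1 (fun y => y 0 j) -> 'd f x v = v 0 j.
Proof. by move=> /funext ->; exact: diff_mxcoord. Qed.

Lemma mxcoord_diff {V : normedModType R} {n} {f : V -> 'rV[R]_n} {x} v i :
  differentiable f x -> ('d f x v) 0 i = 'd (fun y => f y 0 i) x v.
Proof.
move=> df; rewrite -(diff_mxcoord i (f x)).
rewrite -[RHS]/('d ((fun y : 'rV[R]_n => y 0 i) \o f) x v).
by rewrite [in RHS]diff_comp //; exact: differentiable_coord.
Qed.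

Lemma diff_rowE {W : normedModType R} {n} (f : 'rV[R]_n -> W) x v :
  differentiable f x -> 'd f x v = \sum_(i < n) v 0 i *: partial f i x.
Proof.
move=> df; rewrite {1}(row_sum_delta v) linear_sum; apply: eq_bigr => i _.
by rewrite (linearZZ ('d f x)) /partial deriveE.
Qed.

Lemma differentiable_row {V : normedModType R} {n} (f : V -> 'rV[R]_n) x :
  (forall i, differentiable (fun y => f y 0 i) x) -> differentiable f x.
Proof.
move=> df; rewrite (_ : f = \sum_(i < n) (fun y => f y 0 i *: delta_mx 0 i)).
  by apply: differentiable_sum => i; exact: differentiableZl.
by apply/funext => y; rewrite fct_sumE -row_sum_delta.
Qed.

End Differentiability.

(** * The Legendre map on fibers and the regularity of the Hamiltonian *)

Section Legendre.
Context {R : realType}.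
Context (L : 'rV[R]_3 -> R) (L_smooth : smooth L).
Context (FL_diffeo : legendre_bundle_diffeo L).

(** The fiber placed over the base point (0, 0). Any base point would do, since L does not depend on
    x explicitly. *)
Definition embed (q : 'rV[R]_3) : 'rV[R]_5 :=
  vec 5 [:: 0; 0; q 0 0; q 0 1; q 0 2].

Lemma embedK : cancel embed (@fiber R).
Proof. by move=> q; apply/rowP; apply: ord3P; rewrite !mxE. Qed.

Lemma differentiable_fiber (z : 'rV[R]_5) : differentiable (@fiber R) z.
Proof.
apply: differentiable_row; apply: ord3P;
  [apply: (differentiable_eq_coord 2) | apply: (differentiable_eq_coord 3)
  | apply: (differentiable_eq_coord 4)] => y; by rewrite mxE.
Qed.

Lemma diff_fiber (z v : 'rV[R]_5) : 'd (@fiber R) z v = fiber v.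
Proof.
apply/rowP => i; rewrite (mxcoord_diff _ _ (differentiable_fiber z)).
elim/ord3P: i.
- by rewrite (diff_eq_coord 2) ?mxE // => y; rewrite mxE.
- by rewrite (diff_eq_coord 3) ?mxE // => y; rewrite mxE.
- by rewrite (diff_eq_coord 4) ?mxE // => y; rewrite mxE.
Qed.

Lemma differentiable_embed (q : 'rV[R]_3) : differentiable embed q.
Proof.
have d0 (f : 'rV[R]_3 -> R) : f =1 cst 0 -> differentiable f q.
  by move=> /funext ->; exact: differentiable_cst.
apply: differentiable_row; apply: ord5P;
  [apply: d0 | apply: d0 | apply: (differentiable_eq_coord 0)
  | apply: (differentiable_eq_coord 1)
  | apply: (differentiable_eq_coord 2)] => y; by rewrite mxE.
Qed.

Lemma differentiable_energy y : differentiable (energy L) y.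
Proof.
have dp i j : differentiable (fun z => partial L i z * z 0 j) y.
  apply: (@differentiableM _ _ (partial L i) (fun z => z 0 j)).
    exact: smooth_derive_differentiable.
  exact: differentiable_coord.
have dL : differentiable L y by exact: smooth_differentiable.
exact: differentiableB (differentiableD (dp 1 1) (dp 2 2)) dL.
Qed.

Lemma fiber_legendre_coord z :
  fiber (legendre_coord L z) = fiber_legendre L (fiber z).
Proof. by apply/rowP; apply: ord3P; rewrite !mxE. Qed.

Lemma legendre_coord_embed y :
  legendre_coord L (embed y) = embed (fiber_legendre L y).
Proof.
by apply/rowP; apply: ord5P; rewrite !(mxE, embedK) //= /legendre /= embedK.
Qed.

Lemma P_L_coordP w : P_L_coord L w <-> exists z, w = legendre_coord L z.
Proof.
split=> [[_ [z _ <-] <-]|[z ->]]; first by exists z.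
by exists (legendre L z) => //; exists z.
Qed.

(** On the slice over (0, 0) the full Legendre map acts as [fiber_legendre], so its left inverse [g]
    gives injectivity. This makes [pinv] in [Hamiltonian] a genuine inverse on the range. *)
Lemma fiber_legendre_inj : injective (fiber_legendre L).
Proof.
have [_ _ _ _ [g [_ gK _]]] := FL_diffeo.
move=> y y' eq_y; apply: (can_inj embedK); apply: (can_inj gK).
by rewrite !legendre_coord_embed eq_y.
Qed.

Lemma differentiable_Hamiltonian z :
  differentiable (Hamiltonian L) (fiber (legendre_coord L z)).
Proof.
have [PLo _ _ _ [g [g_smooth gK _]]] := FL_diffeo.
(* Moving the point over (0, 0) keeps it in [P_L_coord], the open set on which [g] is smooth. *)
have PLz : P_L_coord L (embed (fiber (legendre_coord L z))).
  apply/P_L_coordP; exists (embed (fiber z)).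
  by rewrite legendre_coord_embed fiber_legendre_coord.
(* On the open set of momenta in the range of the Legendre map, [pinv] is
   [fiber \o g \o embed], which is where the regularity of [H] comes from. *)
pose F := energy L \o @fiber R \o g \o embed.
apply: (@near_eq_differentiable _ _ _ F).
  have : open (embed @^-1` P_L_coord L).
    apply: open_comp => // y _.
    exact/differentiable_continuous/differentiable_embed.
  move=> /(conj PLz)/and_comm/open_nbhs_nbhs.
  apply: filterS => q /= /P_L_coordP[z' qE].
  rewrite /F /Hamiltonian /= qE gK -[q]embedK qE fiber_legendre_coord.
  rewrite pinvKV ?inE //.
  by move=> ? ? _ _; exact: fiber_legendre_inj.
apply: differentiable_comp; first exact: differentiable_embed.
apply: differentiable_comp; first by case: (g_smooth 1%N) => + _; exact.
apply: differentiable_comp; first exact: differentiable_fiber.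
exact: differentiable_energy.
Qed.

(** [H_coord] factors through [fiber], so dH has no components along x^0 and x^1. *)
Lemma dHE z v : dH L (legendre_coord L z) [tuple v] =
    v 0 2 * partial (Hamiltonian L) 0 (fiber (legendre_coord L z))
  + v 0 3 * partial (Hamiltonian L) 1 (fiber (legendre_coord L z))
  + v 0 4 * partial (Hamiltonian L) 2 (fiber (legendre_coord L z)).
Proof.
have dHam := differentiable_Hamiltonian z.
rewrite /dH /dform /H_coord diff_comp //; last exact: differentiable_fiber.
by rewrite /= diff_fiber diff_rowE // big_ord3 !mxE.
Qed.

(** * The section induced by a field, and its three conditions compared with Hamilton's equations *)

Section Field.
Context (phi : 'rV[R]_2 -> R) (phi_smooth : smooth phi).

Lemma differentiable_j1 x : differentiable (j1 phi) x.
Proof.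
apply: differentiable_row; apply: ord5P;
  [apply: (differentiable_eq_coord 0) => y
  | apply: (differentiable_eq_coord 1) => y
  | rewrite (_ : (fun _ => _) = phi)
  | rewrite (_ : (fun _ => _) = partial phi 0)
  | rewrite (_ : (fun _ => _) = partial phi 1)]; rewrite ?mxE //;
  do 1?[exact: smooth_differentiable | exact: smooth_derive_differentiable];
  by apply/funext => y; rewrite mxE.
Qed.

Lemma differentiable_jtilde x : differentiable (jtilde L phi) x.
Proof.
have [_ _ _ lc_smooth _] := FL_diffeo.
apply: differentiable_comp; first exact: differentiable_j1.
exact: smooth_differentiable.
Qed.

(** The Legendre map covers the identity on X, so the first base coordinate of [jtilde] is x^0
    itself. *)
Lemma diff_jtilde0 x v : 'd (jtilde L phi) x v 0 0 = v 0 0.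
Proof.
rewrite (mxcoord_diff _ _ (differentiable_jtilde x)) (diff_eq_coord 0) // => y.
by rewrite !mxE.
Qed.

Lemma diff_jtilde1 x v : 'd (jtilde L phi) x v 0 1 = v 0 1.
Proof.
rewrite (mxcoord_diff _ _ (differentiable_jtilde x)) (diff_eq_coord 1) // => y.
by rewrite !mxE.
Qed.

Lemma partial_jtildeE x i :
  partial (jtilde L phi) i x = 'd (jtilde L phi) x (e_ R i).
Proof. by rewrite /partial deriveE //; exact: differentiable_jtilde. Qed.

Lemma partial_Zfield x i :
  partial (Zfield L phi) i x = fiber (partial (jtilde L phi) i x).
Proof.
have djt := differentiable_jtilde x.
have df := differentiable_fiber (jtilde L phi x).
rewrite partial_jtildeE /partial deriveE; last exact: differentiable_comp.
by rewrite diff_comp //= diff_fiber.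
Qed.

(** The De Donder-Weyl equations, the common form to which each of the three conditions is
    reduced. *)
Definition hamilton_equations : Prop := forall x,
  let T0 := partial (jtilde L phi) 0 x in
  let T1 := partial (jtilde L phi) 1 x in
  let DH i := partial (Hamiltonian L) i (Zfield L phi x) in
  [/\ DH 0 = - (T0 0 3 + T1 0 4), DH 1 = T0 0 2 & DH 2 = T1 0 2].

Lemma dH_jtildeE x v : dH L (jtilde L phi x) [tuple v] =
    v 0 2 * partial (Hamiltonian L) 0 (Zfield L phi x)
  + v 0 3 * partial (Hamiltonian L) 1 (Zfield L phi x)
  + v 0 4 * partial (Hamiltonian L) 2 (Zfield L phi x).
Proof. exact: dHE. Qed.

Lemma covector_hamilton : covector_equation L phi <-> hamilton_equations.
Proof.
have cE x (v : 'rV[R]_5) := congr2 +%R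
    (iprod_wedge_coordinateE _ 3 2 (jtilde L phi x)
       (partial (jtilde L phi) 0 x) v)
    (iprod_wedge_coordinateE _ 4 2 (jtilde L phi x)
       (partial (jtilde L phi) 1 x) v).
split=> [cov x|ham x v].
- apply/covector_components => v; rewrite -dH_jtildeE -cE; exact: cov.
- rewrite (tuple1E _ v) [LHS]cE dH_jtildeE.
  by move: (thead v); apply/covector_components.
Qed.

Lemma Bridges_hamilton : Bridges_equation L phi <-> hamilton_equations.
Proof.
by split=> E x; have := E x; rewrite !partial_Zfield;
  [move=> /Bridges_components | move=> {}E; apply/Bridges_components];
  rewrite !mxE.
Qed.

Lemma Omega_HE z u v w : Omega_H L z [tuple u; v; w] =
  - det3 (coordinate 2) (coordinate 3) (coordinate 1) u v w
  + det3 (coordinate 2) (coordinate 4) (coordinate 0) u v w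
  + det3 (fun y => dH L z [tuple y]) (coordinate 1) (coordinate 0) u v w.
Proof.
have dphiE : (fun y => dphi z [tuple y]) = coordinate 2.
  by apply/funext => y; exact: dcoordinateE.
rewrite -dphiE.
congr (- _ + _ + _); exact: wedge3_coordinateE.
Qed.

Lemma pullback_iprodE U x v w :
  pullback (jtilde L phi) (iprod_form U (Omega_H L)) x [tuple v; w] =
  Omega_H L (jtilde L phi x)
    [tuple U (jtilde L phi x); 'd (jtilde L phi) x v; 'd (jtilde L phi) x w].
Proof.
rewrite /pullback /iprod_form -iprod2E; congr (iprod _ _ _).
exact: val_inj.
Qed.

Lemma diff_jtildeE x v : 'd (jtilde L phi) x v =
  v 0 0 *: partial (jtilde L phi) 0 x + v 0 1 *: partial (jtilde L phi) 1 x.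
Proof. by rewrite diff_rowE ?big_ord2 //; exact: differentiable_jtilde. Qed.

Lemma section_hamilton : Hamiltonian_section L phi <-> hamilton_equations.
Proof.
have s00 x : partial (jtilde L phi) 0 x 0 0 = 1.
  by rewrite partial_jtildeE diff_jtilde0 mxE.
have s01 x : partial (jtilde L phi) 0 x 0 1 = 0.
  by rewrite partial_jtildeE diff_jtilde1 mxE.
have t00 x : partial (jtilde L phi) 1 x 0 0 = 0.
  by rewrite partial_jtildeE diff_jtilde0 mxE.
have t01 x : partial (jtilde L phi) 1 x 0 1 = 1.
  by rewrite partial_jtildeE diff_jtilde1 mxE.
split=> [sec x|ham U _ x v].
(* The condition at [x] sees only the value of [U] at [jtilde L phi x], so constant fields already
   supply every tangent vector [u]. *)
- have {}sec u v w := sec (cst u) (smooth_on_cst _ u) x [tuple v; w].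
  apply/(section_components _ _ _ _ _ (s00 x) (s01 x) (t00 x) (t01 x)).
  move=> u v w /=.
  rewrite -!diff_jtildeE -{}(sec u v w) pullback_iprodE Omega_HE.
  by under [in RHS]eq_fun do rewrite dH_jtildeE.
- rewrite (tuple2E _ v) pullback_iprodE Omega_HE.
  (* Writing dH in components turns it into the linear form [h] of [section_components]. *)
  under eq_fun do rewrite dH_jtildeE.
  rewrite !diff_jtildeE.
  move: (tnth v 0) (tnth v 1) => v0 v1.
  by move/section_components: (ham x); apply.
Qed.

End Field.

End Legendre.

Theorem proposition4p2 (R : realType) (L : 'rV[R]_3 -> R)
    (L_smooth : smooth L)
    (FL_diffeo : legendre_bundle_diffeo L)
    (phi : 'rV[R]_2 -> R) (phi_smooth : smooth phi) :
  (Hamiltonian_section L phi <-> covector_equation L phi) /\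
  (covector_equation L phi <-> Bridges_equation L phi).
Proof.
have sec := section_hamilton _ L_smooth FL_diffeo _ phi_smooth.
have cov := covector_hamilton _ L_smooth FL_diffeo phi.
have bri := Bridges_hamilton _ FL_diffeo _ phi_smooth.
split; first exact: iff_trans sec (iff_sym cov).
exact: iff_trans cov (iff_sym bri).
Qed.
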